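(* Let $\alpha>0$, let $X_{0-}$ be a real-valued random variable and let $Z$ be a continuous stochastic process with $Z_0=0$, independent of $X_{0-}$, satisfying the crossing property (see context). Let $\underline{\Lambda}$ be the minimal solution of the McKean--Vlasov problem and, for $\Delta>0$, let $\underline{\Lambda}^{\Delta}$ be the minimal solution of the discretized McKean--Vlasov problem (see context). Choose a sequence $\Delta_n>0$ such that the discretizations are nested, i.e. $\Delta_n\mathbb{N}\subseteq \Delta_{n+1}\mathbb{N}$ for all $n\in\mathbb{N}$, and $\lim_{n\to\infty}\Delta_n=0$. Assume in addition that either $\operatorname{law}(X_{0-})$ is atomless or $\operatorname{law}(Z_t)$ is atomless for every $t>0$. Then $\lim_{n\to\infty}\underline{\Lambda}^{\Delta_n}=\underline{\Lambda}$ in $M$, i.e. $\alpha^{-1}\underline{\Lambda}^{\Delta_n}_t\to\alpha^{-1}\underline{\Lambda}_t$ for every $t\in[0,\infty]$ at which $\underline{\Lambda}$ is continuous.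
   Context: Crossing property: for every stopping time $\tau$ with respect to the natural filtration of $X_{0-}+Z$ and every $h>0$, $\mathbb{P}(\tau<\infty,\ \inf_{0\le s\le h}(Z_{\tau+s}-Z_\tau)=0)=0$. $M$ denotes the set of càdlàg increasing functions $\ell:\overline{\mathbb{R}}\to[0,1]$ (on the two-point compactification of $\mathbb{R}$) with $\ell_{0-}=0$ and $\ell_\infty=1$, topologized by: $\ell^n\to\ell$ iff $\ell^n_t\to\ell_t$ for every $t\in[0,\infty]$ that is not a discontinuity point of $\ell$. McKean--Vlasov problem: a deterministic function $\Lambda$ is a solution if, with $X_t=X_{0-}+Z_t-\Lambda_t$ and $\tau=\inf\{t\ge0: X_t\le 0\}$, one has $\Lambda_t=\alpha\,\mathbb{P}(\tau\le t)$ for all $t\ge0$; a solution $\underline{\Lambda}$ is minimal if $\underline{\Lambda}_t\le\Lambda_t$ for all $t\ge 0$ and every solution $\Lambda$ (a unique minimal solution exists). For $\Delta>0$ and an increasing function $\ell$ define $X^\Delta_t[\ell]=X_{0-}+Z_{\Delta\lfloor t/\Delta\rfloor}-\alpha\ell_{\Delta\lfloor t/\Delta\rfloor}$, $\tau^\Delta[\ell]=\inf\{t\ge0:X^\Delta_t[\ell]\le0\}$, $\Gamma_\Delta[\ell]_t=\mathbb{P}(\tau^\Delta[\ell]\le t)$. $\Lambda^\Delta$ solves the discretized McKean--Vlasov problem if $\alpha\Gamma_\Delta[\alpha^{-1}\Lambda^\Delta]=\Lambda^\Delta$; a solution $\underline{\Lambda}^\Delta$ is minimal if $\underline{\Lambda}^\Delta\le\Lambda^\Delta$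 for every solution $\Lambda^\Delta$ (under the stated atomless assumption such a minimal solution exists). *)

(* Defs.v *)
From HB Require Import structures.
From mathcomp Require Import all_boot all_order all_algebra.
From mathcomp Require Import all_classical all_reals all_analysis.
Set Implicit Arguments. Unset Strict Implicit. Unset Printing Implicit Defensive.
Import Order.TTheory GRing.Theory Num.Theory.
Import numFieldNormedType.Exports.
Local Open Scope classical_set_scope.
Local Open Scope ring_scope.

Section Defs.
Context {d : measure_display} {T : measurableType d} {R : realType}.
Variable P : probability T R.

Definition hit_time (x : R -> R) : \bar R :=
  ereal_inf [set s%:E | s in [set s | 0 <= s /\ x s <= 0]].

(* X_{0-} independent of the process (Z_t)_{t>=0}: product rule on the
   generating pi-system of sigma(Z_t, t >= 0) *)
Definition indep_X0_Z (X0 : T -> R) (Z : R -> T -> R) : Prop :=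
  forall (A : set R) (n : nat) (ts : 'I_n -> R) (Bs : 'I_n -> set R),
    measurable A -> (forall i, 0 <= ts i) -> (forall i, measurable (Bs i)) ->
    P (X0 @^-1` A `&` \bigcap_(i in [set: 'I_n]) (Z (ts i) @^-1` Bs i)) =
    (P (X0 @^-1` A) * P (\bigcap_(i in [set: 'I_n]) (Z (ts i) @^-1` Bs i)))%E.

Definition nat_filtration (X0 : T -> R) (Z : R -> T -> R) (t : R) : set (set T) :=
  <<s [set E : set T | exists (s : R) (B : set R),
         [/\ 0 <= s <= t, measurable B & E = (fun w => X0 w + Z s w) @^-1` B]] >>.

Definition stopping_time (X0 : T -> R) (Z : R -> T -> R) (tau : T -> \bar R) : Prop :=
  (forall w, (0 <= tau w)%E) /\
  forall t, 0 <= t -> nat_filtration X0 Z t [set w | (tau w <= t%:E)%E].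

Definition crossing_property (X0 : T -> R) (Z : R -> T -> R) : Prop :=
  forall tau, stopping_time X0 Z tau -> forall h : R, 0 < h ->
    P.-negligible [set w | (tau w < +oo)%E /\
      inf [set (Z (fine (tau w) + s) w - Z (fine (tau w)) w)%R | s in `[0, h]%classic] = 0%R].

Definition MV_event (X0 : T -> R) (Z : R -> T -> R) (Lam : R -> R) (t : R) : set T :=
  [set w | (hit_time (fun s => (X0 w + Z s w - Lam s)%R) <= t%:E)%E].

Definition MV_solution (alpha : R) (X0 : T -> R) (Z : R -> T -> R) (Lam : R -> R) : Prop :=
  forall t, 0 <= t ->
    measurable (MV_event X0 Z Lam t) /\ Lam t = alpha * fine (P (MV_event X0 Z Lam t)).

Definition MV_minimal_solution alpha X0 Z Lam : Prop :=
  MV_solution alpha X0 Z Lam /\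
  forall Lam', MV_solution alpha X0 Z Lam' -> forall t, 0 <= t -> Lam t <= Lam' t.

Definition disc (Delta t : R) : R := (Num.floor (t / Delta))%:~R * Delta.

Definition disc_event (alpha : R) (X0 : T -> R) (Z : R -> T -> R) (Delta : R)
    (l : R -> R) (t : R) : set T :=
  [set w | (hit_time (fun s => (X0 w + Z (disc Delta s) w - alpha * l (disc Delta s))%R)
              <= t%:E)%E].

Definition Gamma (alpha : R) X0 Z Delta (l : R -> R) (t : R) : R :=
  fine (P (disc_event alpha X0 Z Delta l t)).

Definition disc_MV_solution (alpha : R) X0 Z (Delta : R) (Lam : R -> R) : Prop :=
  forall t, 0 <= t ->
    measurable (disc_event alpha X0 Z Delta (fun s => alpha^-1 * Lam s) t) /\
    alpha * Gamma alpha X0 Z Delta (fun s => alpha^-1 * Lam s) t = Lam t.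

Definition disc_MV_minimal_solution alpha X0 Z Delta Lam : Prop :=
  disc_MV_solution alpha X0 Z Delta Lam /\
  forall Lam', disc_MV_solution alpha X0 Z Delta Lam' ->
    forall t, 0 <= t -> Lam t <= Lam' t.

End Defs.

(* element of M associated with Lam: l = alpha^-1 Lam on [0,oo), l = 0 before 0
   (l_{0-} = 0) *)
Definition M_elt {R : realType} (alpha : R) (Lam : R -> R) (t : R) : R :=
  if t < 0 then 0 else alpha^-1 * Lam t.

(* Main.v *)
(* The minimal discretized solution lies below every super-solution
   (Knaster-Tarski), so the minimal discretized solutions increase with the nested
   grids and stay below the minimal solution Lmin of the continuous problem.
   Let Linf be their pointwise limit and Lr its right limit.  Discrete hits are
   hits for Lr, whence Lr <= alpha P(tau <= .).  Conversely let tau be the hitting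
   time for Lr: by the crossing property Z almost surely dips strictly below Z_tau
   right after tau, and Linf >= Lr_tau there, so X is strictly negative for Linf on
   an open set of times, which contains points of all sufficiently fine grids;
   hence some discretization is hit as well.  So Lr solves the continuous problem,
   Lmin <= Lr, and Linf = Lmin wherever Lmin is left-continuous. *)
Require Import Defs.
From HB Require Import structures.
From mathcomp Require Import all_boot all_order all_algebra.
From mathcomp Require Import all_classical all_reals all_analysis.
From mathcomp Require Import measurable_realfun lra.
Import Order.TTheory GRing.Theory Num.Theory.
Import numFieldNormedType.Exports.
Local Open Scope classical_set_scope.
Local Open Scope ring_scope.

(** * Least fixed points of monotone maps on functions over the half-line *)

(** The pointwise infimum [m] of all [f] with [F f <= f] satisfies [F m <= m] by monotonicity; then
    [F m] is itself such an [f], which gives [m <= F m]. Nonnegativity of [F] bounds the real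
    infimum from below, and [g] makes the family nonempty. *)
Lemma knaster_tarski_ge0 {R : realType} (F : (R -> R) -> R -> R) (g : R -> R) :
  (forall f f', (forall t, 0 <= t -> f t <= f' t) ->
    forall t, 0 <= t -> F f t <= F f' t) ->
  (forall f t, 0 <= t -> 0 <= F f t) ->
  (forall t, 0 <= t -> F g t <= g t) ->
  exists2 f, (forall t, 0 <= t -> F f t = f t) & forall t, 0 <= t -> f t <= g t.
Proof.
move=> Fhomo F0 Fg.
pose S : set (R -> R) := [set f | forall t, 0 <= t -> F f t <= f t].
pose m t := inf [set f t | f in S].
have mS f t : S f -> 0 <= t -> m t <= f t.
  move=> Sf t0; apply: ge_inf; last by exists f.
  by exists 0 => _ [f' Sf' <-]; exact: le_trans (F0 _ _ t0) (Sf' _ t0).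
have Fm t : 0 <= t -> F m t <= m t.
  move=> t0; apply: lb_le_inf; first by exists (g t), g.
  move=> _ [f Sf <-]; apply: le_trans (Sf _ t0).
  by apply: Fhomo => // s s0; exact: mS.
exists m => t t0; last exact: mS.
apply/eqP; rewrite eq_le Fm //=; apply: mS => // s s0.
exact: Fhomo.
Qed.

(** * Semicontinuity and hitting times of a single path *)

Definition lsc_ge0 {R : realType} (x : R -> R) : Prop :=
  forall s a, 0 <= s -> a < x s ->
  exists2 e, 0 < e & forall r, 0 <= r -> `|r - s| < e -> a < x r.

(** For an increasing function this is right-continuity. *)
Definition usc_right_ge0 {R : realType} (x : R -> R) : Prop :=
  forall s a, 0 <= s -> x s < a ->
  exists2 e, 0 < e & forall r, s <= r -> r < s + e -> x r < a.

Section hitting_times.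
Context {R : realType}.
Implicit Types (x : R -> R) (t : R).

Lemma hit_time_ge0 x : (0 <= hit_time x)%E.
Proof. by apply: le_ereal_inf_tmp => _ [s [s0 _] <-]; rewrite lee_fin. Qed.

Lemma hit_time_le x s : 0 <= s -> x s <= 0 -> (hit_time x <= s%:E)%E.
Proof. by move=> s0 xs; apply: ereal_inf_lbound; exists s. Qed.

(** If [x] were positive on all of [0, t], lower semicontinuity at [t] would keep it positive
    slightly beyond [t], pushing the hitting time strictly past [t]. *)
Lemma hit_time_le_exists x t : lsc_ge0 x -> 0 <= t ->
  (hit_time x <= t%:E)%E -> exists2 s, 0 <= s <= t & x s <= 0.
Proof.
move=> xlsc t0 xt; apply: contrapT => nx.
have xgt0 s : 0 <= s -> s <= t -> 0 < x s.
  by move=> s0 st; rewrite ltNge; apply/negP => xs; apply: nx; exists s; rewrite ?s0.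
have [e e0 xe] := xlsc _ _ t0 (xgt0 _ t0 (lexx t)).
have : ((t + e)%:E <= hit_time x)%E.
  apply: le_ereal_inf_tmp => _ [s [s0 xs] <-].
  rewrite lee_fin leNgt; apply/negP => ste.
  have [st|ts] := leP s t; first by have := xgt0 _ s0 st; rewrite ltNge xs.
  have : 0 < x s by apply: xe => //; rewrite gtr0_norm; lra.
  by rewrite ltNge xs.
move=> /le_trans /(_ xt); rewrite lee_fin; lra.
Qed.

Lemma hit_time_attained x t : lsc_ge0 x -> 0 <= t ->
  (hit_time x <= t%:E)%E ->
  exists s, [/\ 0 <= s <= t, hit_time x = s%:E & x s <= 0].
Proof.
move=> xlsc t0 xt.
have [s hs] : exists s, hit_time x = s%:E.
  case E : (hit_time x) (hit_time_ge0 x) xt => [s| |] //= _ _; by exists s.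
have s0 : 0 <= s by rewrite -lee_fin -hs hit_time_ge0.
have st : s <= t by rewrite -lee_fin -hs.
have [|r /andP[r0 rs] xr] := hit_time_le_exists x s xlsc s0.
  by rewrite hs.
have sr : s <= r by rewrite -lee_fin -hs hit_time_le.
by exists s; split=> //; [rewrite s0|have -> : s = r by lra].
Qed.

(** This makes hitting events countable combinations of one-time events. A zero is replaced by
    rational times just to its right; conversely, a lower semicontinuous function that is positive
    on a compact interval has a positive lower bound there. *)
Lemma exists_le0_countable x t : lsc_ge0 x -> usc_right_ge0 x -> 0 <= t ->
  (exists2 s, 0 <= s <= t & x s <= 0) <->
  (forall k : nat, exists r, [/\ r = t \/ exists q : rat, r = ratr q,
     0 <= r <= t & x r < k.+1%:R^-1]).
Proof.
move=> xlsc xusc t0; split=> [[s /andP[s0 st] xs] k|xk].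
  have xsk : x s < k.+1%:R^-1 by apply: le_lt_trans xs _; rewrite invr_gt0.
  move: st; rewrite le_eqVlt => /predU1P[st|st].
    (* A hit at the endpoint leaves no room for a rational to its right inside [0, t], so [t] itself
       belongs to the countable set of times. *)
    by exists t; split; [left|rewrite t0 lexx|rewrite -st].
  have [e e0 xe] := xusc _ _ s0 xsk.
  have sm : s < Num.min t (s + e) by rewrite lt_min st; lra.
  have [q] := rat_in_itvoo sm.
  rewrite in_itv /= lt_min => /and3P[sq qt qe].
  exists (ratr q); split; [by right; exists q|lra|apply: xe => //; lra].
apply: contrapT => nx.
have xgt0 s : 0 <= s -> s <= t -> 0 < x s.
  by move=> s0 st; rewrite ltNge; apply/negP => xs; apply: nx; exists s; rewrite ?s0.
(* Compactness in its filter form: near each [s], [x] stays above [x s / 2], hence above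
   [k.+1%:R^-1] for large [k]; one [N] then works on all of [0, t]. *)
have /compact_near_coveringP := @segment_compact R 0 t.
move=> /(_ nat \oo (fun k r => 0 <= r <= t -> k.+1%:R^-1 <= x r) _) [].
  move=> s; rewrite /= in_itv /= => /andP[s0 st].
  have xs2 : x s / 2 < x s by have := xgt0 s s0 st; lra.
  have [e e0 xe] := xlsc _ _ s0 xs2.
  have xs20 : 0 < x s / 2 by have := xgt0 s s0 st; lra.
  exists (ball s e, [set k : nat | k.+1%:R^-1 < x s / 2]) => /=.
    split; first exact: nbhsx_ballx.
    exact: (near_infty_natSinv_lt (PosNum xs20)).
  move=> [r k] /= [/= sr kx] /andP[r0 rt].
  apply/ltW/(lt_trans kx)/xe => //.
  by move: sr; rewrite /ball /= distrC.
move=> N _ /(_ N (leqnn N)) /= Nx.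
have [r [_ rt xr]] := xk N.
by have := Nx r; rewrite /= in_itv /= rt => /(_ isT isT); rewrite leNgt xr.
Qed.

End hitting_times.

(** * Path regularity and measurability of hitting events *)

Lemma within_continuous_ge0 {R : realType} (z : R -> R) (s a : R) :
  {within `[0, +oo[, continuous z} -> 0 <= s -> 0 < a ->
  exists2 e, 0 < e & forall r, 0 <= r -> `|r - s| < e -> `|z r - z s| < a.
Proof.
move=> /subspace_continuousP zc s0 a0.
have s_in : `[0%R, +oo[%classic s by rewrite /= in_itv /= s0.
have /cvgrPdist_lt /(_ _ a0) := zc s s_in.
rewrite near_withinE => /nbhs_ballP[e /= e0 ez].
exists e => // r r0 rs; rewrite distrC; apply: ez.
  by rewrite /ball /= distrC.
by rewrite /= in_itv /= r0.
Qed.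

(** Left of [s] monotonicity gives [L r <= L s]; right of [s] right-continuity of [L] controls the
    increase. The gap is split evenly between [z] and [L]. *)
Lemma lsc_ge0_path {R : realType} (c : R) (z L : R -> R) :
  {within `[0, +oo[, continuous z} ->
  {in Num.nneg &, {homo L : s t / s <= t}} -> usc_right_ge0 L ->
  lsc_ge0 (fun s => c + z s - L s).
Proof.
move=> zc Lhomo Lusc s a s0 ax.
pose b := (c + z s - L s - a) / 2.
have b0 : 0 < b by rewrite /b; lra.
have [e e0 ze] := within_continuous_ge0 _ _ _ zc s0 b0.
have [|e' e'0 Le'] := Lusc s (L s + b) s0; first by lra.
exists (Num.min e e'); first by rewrite lt_min e0.
move=> r r0; rewrite lt_min => /andP[re re'].
have := ze _ r0 re; rewrite ltr_norml => /andP[zr _].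
suff : L r < L s + b by move=> Lr; rewrite /b in zr Lr; lra.
have [sr|rs] := leP s r.
  by apply: Le' => //; move: re'; rewrite ltr_norml; lra.
have : L r <= L s by apply: Lhomo; rewrite ?nnegrE // ltW.
lra.
Qed.

Lemma usc_right_ge0_path {R : realType} (c : R) (z L : R -> R) :
  {within `[0, +oo[, continuous z} ->
  {in Num.nneg &, {homo L : s t / s <= t}} ->
  usc_right_ge0 (fun s => c + z s - L s).
Proof.
move=> zc Lhomo s a s0 xa.
have b0 : 0 < a - (c + z s - L s) by lra.
have [e e0 ze] := within_continuous_ge0 _ _ _ zc s0 b0.
exists e => // r sr rse.
have r0 : 0 <= r by lra.
have := ze _ r0; rewrite ger0_norm ?subr_ge0//.
move=> /(_ ltac:(lra)); rewrite ltr_norml => /andP[_ zr].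
have : L s <= L r by apply: Lhomo; rewrite ?nnegrE.
lra.
Qed.

Section processes.
Context {d : measure_display} {T : measurableType d} {R : realType}.
Context (P : probability T R) (X0 : T -> R) (Z : R -> T -> R).
Implicit Types L : R -> R.

Lemma MV_event_nat_filtration L (t : R) :
  (forall w, {within `[0, +oo[, continuous (Z ^~ w)}) ->
  {in Num.nneg &, {homo L : r s / r <= s}} -> usc_right_ge0 L -> 0 <= t ->
  nat_filtration X0 Z t (MV_event X0 Z L t).
Proof.
move=> Zc Lhomo Lusc t0.
(* [G] generates the filtration at [t]. Each [F k r] lies in [G] because [L] is deterministic, or is
   empty when [r] is outside [0, t]. *)
pose G := [set E : set T | exists (s : R) (B : set R),
         [/\ 0 <= s <= t, measurable B & E = (fun w => X0 w + Z s w) @^-1` B]].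
pose F k r := [set w | 0 <= r <= t /\ X0 w + Z r w - L r < k.+1%:R^-1].
have -> : MV_event X0 Z L t =
    \bigcap_k (F k t `|` \bigcup_(q : rat) F k (ratr q)).
  have lscX w := lsc_ge0_path (X0 w) _ _ (Zc w) Lhomo Lusc.
  have uscX w := usc_right_ge0_path (X0 w) _ _ (Zc w) Lhomo.
  apply/seteqP; split => w.
    move=> /(hit_time_le_exists _ _ (lscX w) t0).
    move=> /(exists_le0_countable _ _ (lscX w) (uscX w) t0) xk k _.
    have [r [[->|[q ->]] rt xr]] := xk k; first by left.
    by right; exists q.
  move=> wF.
  have [|s /andP[s0 st] xs] :=
      (exists_le0_countable _ _ (lscX w) (uscX w) t0).2.
    move=> k; have [[rt xr]|[q _ [rt xr]]] := wF k I.
      by exists t; split; [left| |].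
    by exists (ratr q); split; [right; exists q| |].
  by apply: le_trans (hit_time_le _ _ s0 xs) _; rewrite lee_fin.
have mF k r : measurable (F k r : set (g_sigma_algebraType G)).
  have [rt|nrt] := pselect (0 <= r <= t); last first.
    by rewrite (_ : F k r = set0)//; apply/seteqP; split => // w [].
  apply: sub_sigma_algebra; exists r, `]-oo, (L r + k.+1%:R^-1)[%classic.
  split=> //; apply/seteqP; split => w; rewrite /F /= in_itv /=.
    by move=> [_]; rewrite ltrBlDl.
  by rewrite ltrBlDl.
change (measurable ((\bigcap_k (F k t `|` \bigcup_(q : rat) F k (ratr q)))
  : set (g_sigma_algebraType G))).
apply: bigcapT_measurable => k; apply: measurableU; first exact: mF.
by apply: bigcupT_measurable_rat => q; exact: mF.
Qed.

Hypothesis mX0 : measurable_fun setT X0.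
Hypothesis mZ : forall t, 0 <= t -> measurable_fun setT (Z t).

Lemma nat_filtration_measurable (t : R) (A : set T) :
  nat_filtration X0 Z t A -> measurable A.
Proof.
apply: smallest_sub; first exact: sigma_algebra_measurable.
move=> _ [s [B [/andP[s0 _] mB ->]]].
by rewrite -[X in measurable X]setTI; apply: measurable_funD => //; exact: mZ.
Qed.

(** * The discretized problem expressed on grid points *)

Definition grid_event (D : R) L (t : R) : set T :=
  \bigcup_(j in [set j : nat | j%:R * D <= t])
    [set w | X0 w + Z (j%:R * D) w <= L (j%:R * D)].

Lemma measurable_grid_event (D : R) L (t : R) :
  0 < D -> measurable (grid_event D L t).
Proof.
move=> D0; apply: bigcup_measurable => j _.
rewrite (_ : [set _ | _] =
    (fun w => X0 w + Z (j%:R * D) w) @^-1` `]-oo, L (j%:R * D)]%classic).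
  rewrite -[X in measurable X]setTI.
  by apply: measurable_funD => //; apply: mZ; rewrite mulr_ge0 ?ler0n // ltW.
by apply/seteqP; split => w /=; rewrite in_itv.
Qed.

(** The discretized path is constant between grid points, so a hit at [s] is already a hit at the
    grid point [disc D s]. *)
Lemma disc_event_grid (alpha D : R) L (t : R) :
  0 < alpha -> 0 < D -> 0 <= t ->
  disc_event alpha X0 Z D (fun s => alpha^-1 * L s) t = grid_event D L t.
Proof.
move=> alpha0 D0 t0.
have disc_le s : disc D s <= s.
  by rewrite /disc -ler_pdivlMr // floor_le.
have disc_gt s : s < disc D s + D.
  rewrite /disc -{3}[D]mul1r -mulrDl -ltr_pdivrMr //.
  by have := floorD1_gt (s / D); rewrite intrD.
have disc_nat s : 0 <= s -> exists j : nat, disc D s = j%:R * D.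
  move=> s0; have : 0 <= Num.floor (s / D) by rewrite floor_ge0 divr_ge0 // ltW.
  by rewrite /disc; case: (Num.floor _) => // j _; exists j.
have disc_grid (j : nat) : disc D (j%:R * D) = j%:R * D.
  by rewrite /disc mulfK ?gt_eqF // -[j%:R]/(j%:Z%:~R) intrKfloor.
apply/seteqP; split => w; rewrite /disc_event /grid_event /=; last first.
  move=> [j /= jt wj].
  have j0 : 0 <= j%:R * D by rewrite mulr_ge0 ?ler0n // ltW.
  apply: (@le_trans _ _ (j%:R * D)%:E); last by rewrite lee_fin.
  by apply: hit_time_le => //; rewrite disc_grid mulVKf ?gt_eqF // subr_le0.
move=> wt.
(* Comparing strictly with the next grid point after [t] produces an actual hit [s], possibly later
   than [t], whose grid point is still at most [disc D t]. *)
have /ereal_inf_lt[_ [s [s0 ws] <-]] :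
    (hit_time (fun s => X0 w + Z (disc D s) w
       - alpha * (alpha^-1 * L (disc D s)))%R < (disc D t + D)%:E)%E.
  by apply: le_lt_trans wt _; rewrite lte_fin.
rewrite lte_fin => st; move: ws; rewrite mulVKf ?gt_eqF // subr_le0.
have [j sj] := disc_nat s s0; have [i ti] := disc_nat t t0.
rewrite sj => ws; exists j => //=.
have ji : (j < i.+1)%N.
  rewrite -(ltr_nat R) -(ltr_pM2r D0) -sj -natr1 mulrDl mul1r -ti.
  exact: le_lt_trans (disc_le s) st.
apply: le_trans (disc_le t); rewrite ti ler_pM2r // ler_nat.
by rewrite -ltnS.
Qed.

Lemma fine_probability_le (A B : set T) :
  measurable A -> measurable B -> A `<=` B -> fine (P A) <= fine (P B).
Proof.
move=> mA mB AB; apply: fine_le; rewrite ?fin_num_measure //.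
by apply: le_measure; rewrite ?inE.
Qed.

(** The super-solution [L'] dominates a fixed point of the grid map, which is a discretized solution
    and therefore dominates the minimal one. *)
Lemma disc_MV_minimal_le (alpha D : R) L L' :
  0 < alpha -> 0 < D -> disc_MV_minimal_solution P alpha X0 Z D L ->
  (forall t, 0 <= t -> alpha * fine (P (grid_event D L' t)) <= L' t) ->
  forall t, 0 <= t -> L t <= L' t.
Proof.
move=> alpha0 D0 [_ Lmin] L'sup.
have [||f fE fL' t t0] :=
    knaster_tarski_ge0 (fun g t => alpha * fine (P (grid_event D g t))) L' _ _ L'sup.
- move=> f f' ff' t t0; rewrite ler_pM2l //.
  apply: fine_probability_le; try exact: measurable_grid_event.
  move=> w [j jt wj]; exists j => //=; apply: le_trans wj _.
  by apply: ff'; rewrite mulr_ge0 ?ler0n // ltW.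
- by move=> f t _; rewrite mulr_ge0 ?fine_ge0 // ltW.
apply: le_trans (fL' _ t0); apply: Lmin => // s s0.
rewrite /Gamma disc_event_grid //; split; last exact: fE.
exact: measurable_grid_event.
Qed.

Lemma disc_MV_solutionE (alpha D : R) L (t : R) :
  0 < alpha -> 0 < D -> disc_MV_solution P alpha X0 Z D L -> 0 <= t ->
  L t = alpha * fine (P (grid_event D L t)).
Proof.
by move=> alpha0 D0 sL t0; rewrite -(sL t t0).2 /Gamma disc_event_grid.
Qed.

End processes.

(** * Right limits as infima over later times *)

Definition right_lim {R : realType} (f : R -> R) (t : R) : R :=
  inf [set f s | s in [set s | t < s]].

Section right_limits.
Context {R : realType} (f : R -> R).
Hypothesis f0 : forall t, 0 <= t -> 0 <= f t.

Lemma right_lim_le (s t : R) : 0 <= s -> s < t -> right_lim f s <= f t.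
Proof.
move=> s0 st; apply: ge_inf; last by exists t.
by exists 0 => _ [r /= sr <-]; apply: f0; lra.
Qed.

Lemma le_right_lim (a t : R) : (forall s, t < s -> a <= f s) -> a <= right_lim f t.
Proof.
move=> af; apply: lb_le_inf; first by exists (f (t + 1)), (t + 1) => //=; lra.
by move=> _ [s /= ts <-]; exact: af.
Qed.

Lemma right_lim_homo : {in Num.nneg &, {homo right_lim f : s t / s <= t}}.
Proof.
move=> s t; rewrite !nnegrE => s0 t0 st; apply: le_right_lim => r tr.
by apply: right_lim_le => //; lra.
Qed.

(** A near-minimizer [r] of the infimum at [s] bounds [right_lim f] at every point of [s, r). *)
Lemma right_lim_usc : usc_right_ge0 (right_lim f).
Proof.
move=> s a s0 sa.
have [] := @inf_adherent R [set f r | r in [set r | s < r]] (a - right_lim f s).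
- by rewrite subr_gt0.
- split; first by exists (f (s + 1)), (s + 1) => //=; lra.
  by exists 0 => _ [r /= sr <-]; apply: f0; lra.
move=> _ [r /= sr <-] fr; exists (r - s); first by rewrite subr_gt0.
move=> u su ur; apply: (@le_lt_trans _ _ (f r)).
  by apply: right_lim_le; lra.
by move: fr; rewrite /right_lim; lra.
Qed.

End right_limits.

(** * The limit of the discretized solutions solves the continuous problem *)

Section limit_of_discretizations.
Context {d : measure_display} {T : measurableType d} {R : realType}.
Context (P : probability T R) (X0 : T -> R) (Z : R -> T -> R).
Context (alpha : R) (Delta : nat -> R) (L : nat -> R -> R).
Hypothesis alpha0 : 0 < alpha.
Hypothesis mX0 : measurable_fun setT X0.
Hypothesis mZ : forall t, 0 <= t -> measurable_fun setT (Z t).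
Hypothesis Zc : forall w, {within `[0, +oo[, continuous (Z ^~ w)}.
Hypothesis cross : crossing_property P X0 Z.
Hypothesis Delta0 : forall n, 0 < Delta n.
Hypothesis nested : forall n k : nat, exists m : nat,
  k%:R * Delta n = m%:R * Delta n.+1.
Hypothesis Delta_cvg0 : Delta @ \oo --> 0.
Hypothesis LE : forall n t, 0 <= t ->
  L n t = alpha * fine (P (grid_event X0 Z (Delta n) (L n) t)).
Hypothesis L_leS : forall n t, 0 <= t -> L n t <= L n.+1 t.

Let Linf t := sup (range (L ^~ t)).
Let Lr := right_lim Linf.

Let mgrid n t : measurable (grid_event X0 Z (Delta n) (L n) t).
Proof. exact: measurable_grid_event. Qed.

Lemma disc_solution_ge0 n t : 0 <= t -> 0 <= L n t.
Proof. by move=> t0; rewrite LE // mulr_ge0 ?fine_ge0 // ltW. Qed.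

Lemma disc_solution_ubound t : 0 <= t -> has_ubound (range (L ^~ t)).
Proof.
move=> t0; exists alpha => _ [n _ <-]; rewrite LE //; apply: ler_piMr; first exact: ltW.
rewrite -[leRHS]/(fine 1%E); apply: fine_le; rewrite ?fin_num_measure //.
exact: probability_le1.
Qed.

Lemma le_disc_limit n t : 0 <= t -> L n t <= Linf t.
Proof. by move=> t0; apply: ub_le_sup; [exact: disc_solution_ubound|exists n]. Qed.

Lemma disc_limit_ge0 t : 0 <= t -> 0 <= Linf t.
Proof.
by move=> t0; apply: le_trans (le_disc_limit 0 _ t0); exact: disc_solution_ge0.
Qed.

Lemma disc_solution_homo n : {in Num.nneg &, {homo L n : s t / s <= t}}.
Proof.
move=> s t; rewrite !nnegrE => s0 t0 st; rewrite !LE // ler_pM2l //.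
apply: fine_probability_le => // w [j /= js wj]; exists j => //=.
exact: le_trans st.
Qed.

Lemma disc_limit_homo : {in Num.nneg &, {homo Linf : s t / s <= t}}.
Proof.
move=> s t s0 t0 st; apply: ge_sup; first by exists (L 0%N s), 0%N.
move=> _ [n _ <-]; apply: le_trans (le_disc_limit n _ t0).
exact: disc_solution_homo.
Qed.

Lemma disc_limit_le_right_lim t : 0 <= t -> Linf t <= Lr t.
Proof.
move=> t0; apply: le_right_lim => s ts.
by apply: disc_limit_homo; rewrite ?nnegrE //; lra.
Qed.

Lemma disc_solution_nondecreasing n m t : 0 <= t -> (n <= m)%N -> L n t <= L m t.
Proof.
move=> t0; apply: (@homo_leq R (L ^~ t) (fun x y => x <= y)) => //.
  exact: le_trans.
by move=> k; exact: L_leS.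
Qed.

Lemma nested_le n m k : (n <= m)%N ->
  exists k' : nat, k%:R * Delta n = k'%:R * Delta m.
Proof.
move=> /subnK <-; elim: (m - n)%N => [|p [k' IH]]; first by exists k.
by rewrite IH; exact: nested.
Qed.

Lemma grid_event_nondecreasing n m t : (n <= m)%N ->
  grid_event X0 Z (Delta n) (L n) t `<=` grid_event X0 Z (Delta m) (L m) t.
Proof.
move=> nm w [j /= jt wj]; have [j' jj'] := nested_le n m j nm.
exists j' => /=; rewrite -jj' //; apply: le_trans wj _.
by apply: disc_solution_nondecreasing => //; rewrite mulr_ge0 ?ler0n // ltW.
Qed.

Lemma grid_event_sub_MV_event n t :
  grid_event X0 Z (Delta n) (L n) t `<=` MV_event X0 Z Lr t.
Proof.
move=> w [j /= jt wj].
have j0 : 0 <= j%:R * Delta n by rewrite mulr_ge0 ?ler0n // ltW.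
apply: (@le_trans _ _ (j%:R * Delta n)%:E); last by rewrite lee_fin.
apply: hit_time_le => //; rewrite subr_le0; apply: le_trans wj _.
exact: le_trans (le_disc_limit _ _ j0) (disc_limit_le_right_lim _ j0).
Qed.

Let Lr_homo : {in Num.nneg &, {homo Lr : s t / s <= t}}.
Proof. exact/right_lim_homo/disc_limit_ge0. Qed.

Let Lr_usc : usc_right_ge0 Lr.
Proof. exact/right_lim_usc/disc_limit_ge0. Qed.

Lemma nat_filtration_MV_event_limit t : 0 <= t ->
  nat_filtration X0 Z t (MV_event X0 Z Lr t).
Proof. exact: MV_event_nat_filtration. Qed.

Let mMV t : 0 <= t -> measurable (MV_event X0 Z Lr t).
Proof.
by move=> t0; apply: nat_filtration_measurable (nat_filtration_MV_event_limit _ t0).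
Qed.

(** The bound [Linf <= alpha * P] holds at times [t + k.+1%:R^-1], strictly after [t], where [Linf]
    dominates [Lr t]; continuity of [P] from above then brings the time back to [t]. *)
Lemma limit_le_hitting t : 0 <= t -> Lr t <= alpha * fine (P (MV_event X0 Z Lr t)).
Proof.
move=> t0.
pose A k := MV_event X0 Z Lr (t + k.+1%:R^-1).
have tk0 k : 0 <= t + k.+1%:R^-1 by rewrite addr_ge0 // invr_ge0.
have mA k : measurable (A k) by exact: mMV.
have capA : \bigcap_k A k = MV_event X0 Z Lr t.
  apply/seteqP; split => w wA; last first.
    move=> k _; apply: le_trans wA _.
    by rewrite lee_fin lerDl invr_ge0.
  apply/lee_addgt0Pr => e e0.
  have [k _ /(_ k (leqnn k)) /= ke] := near_infty_natSinv_lt (PosNum e0).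
  apply: le_trans (wA k I) _; rewrite -EFinD lee_fin lerD2l.
  exact: ltW.
have PA : P \o A @ \oo --> P (MV_event X0 Z Lr t).
  rewrite -capA; apply: nonincreasing_cvg_mu => //.
  - by rewrite ltey_eq fin_num_measure.
  - exact: bigcapT_measurable.
  - move=> n m nm; apply/subsetPset => w wA; apply: le_trans wA _.
    by rewrite lee_fin lerD2l lef_pV2 ?posrE // ler_nat ltnS.
rewrite -ler_pdivrMl // -lee_fin fineK ?fin_num_measure //; last exact: mMV.
rewrite -(cvg_lim _ PA) //; apply: lime_ge; first by apply/cvg_ex; eexists; exact: PA.
apply: nearW => k /=; rewrite -[leRHS]fineK ?fin_num_measure // lee_fin.
rewrite ler_pdivrMl //; apply: (@le_trans _ _ (Linf (t + k.+1%:R^-1))).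
  apply: right_lim_le => //; first exact: disc_limit_ge0.
  by rewrite ltrDl invr_gt0.
apply: ge_sup; first by exists (L 0%N (t + k.+1%:R^-1)), 0%N.
move=> _ [n _ <-]; rewrite LE // ler_pM2l //.
by apply: fine_probability_le => //; exact: grid_event_sub_MV_event.
Qed.

(* [Linf r >= Lr s0] for every [r > s0], so the dip of [Z] at [s0 + u] makes
   [X0 + Z - Linf] negative at any grid point in [(s0, s0 + u]] close to [s0 + u]. *)
Lemma dip_grid_event w (s0 u s : R) :
  0 <= s0 -> 0 <= u -> s0 + u < s -> X0 w + Z s0 w - Lr s0 <= 0 ->
  Z (s0 + u) w < Z s0 w ->
  exists n, grid_event X0 Z (Delta n) (L n) s w.
Proof.
move=> s00 u0 us hit dip.
have u_gt0 : 0 < u.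
  by rewrite lt_neqAle u0 andbT; apply/eqP => u00; move: dip; rewrite -u00 addr0 ltxx.
have dip0 : 0 < Z s0 w - Z (s0 + u) w by rewrite subr_gt0.
have su0 : 0 <= s0 + u by lra.
have [e e0 eZ] := within_continuous_ge0 _ _ _ (Zc w) su0 dip0.
(* A mesh below [e] puts the chosen grid point where [Z] is still below its value at [s0]; a mesh
   below [u] keeps that point strictly after [s0], where [Linf] is at least [Lr s0]. *)
have eu0 : 0 < Num.min e u by rewrite lt_min e0.
have /cvgrPdist_lt /(_ _ eu0) [n _ /(_ n (leqnn n))] := Delta_cvg0.
rewrite sub0r normrN gtr0_norm // lt_min => /andP[ne nu].
have [j jlow jup] : exists2 j : nat, j%:R * Delta n <= s0 + u
    & s0 + u < j%:R * Delta n + Delta n.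
  have : 0 <= Num.floor ((s0 + u) / Delta n) by rewrite floor_ge0 divr_ge0 // ltW.
  have := floor_itv ((s0 + u) / Delta n).
  case: (Num.floor _) => // j; rewrite intrD => /andP[jle jlt] _.
  exists j; first by rewrite -ler_pdivlMr.
  by rewrite -{2}[Delta n]mul1r -mulrDl -ltr_pdivrMr.
set r := j%:R * Delta n in jlow jup.
have r0 : 0 <= r by rewrite mulr_ge0 ?ler0n // ltW.
have re : `|r - (s0 + u)| < e by rewrite ltr_norml; lra.
have := eZ r r0 re; rewrite ltr_norml => /andP[_ Zr].
have Lr_r : Lr s0 <= Linf r by apply: right_lim_le => //; [exact: disc_limit_ge0|lra].
(* Since [X0 w + Z r w < Linf r], some [L m] already exceeds the left side at [r]. The index
   [maxn n m] has [r] on its grid and a solution at least [L m]. *)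
have [] := @sup_adherent R (range (L ^~ r)) (Linf r - (X0 w + Z r w)).
- by lra.
- by split; [exists (L 0%N r), 0%N|exact: disc_solution_ubound].
move=> _ [m _ <-]; rewrite opprB addrC addrNK => Lm.
have [j' jj'] := nested_le n (maxn n m) j (leq_maxl _ _).
exists (maxn n m), j' => /=; rewrite -jj' -/r; first by lra.
apply: le_trans (ltW Lm) _.
by apply: disc_solution_nondecreasing => //; exact: leq_maxr.
Qed.

(** Almost surely, a hit for [Lr] by time [t] forces a hit on some grid by time [s]. The grid events
    increase with [n], so the probability of their union is the limit of theirs, each at most
    [alpha^-1 * Linf s]. *)
Lemma hitting_le_disc_limit s t : 0 <= t -> t < s ->
  alpha * fine (P (MV_event X0 Z Lr t)) <= Linf s.
Proof.
move=> t0 ts; have s0 : 0 <= s by lra.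
pose G n := grid_event X0 Z (Delta n) (L n) s.
pose tau w := hit_time (fun r => X0 w + Z r w - Lr r).
have tau_stop : stopping_time X0 Z tau.
  split=> [w|r r0]; first exact: hit_time_ge0.
  exact: nat_filtration_MV_event_limit.
(* Half of the slack keeps every dip time [s1 + u] strictly before [s]. *)
have h0 : 0 < (s - t) / 2 by lra.
have [N [mN PN subN]] := cross _ tau_stop _ h0.
have mG : measurable (\bigcup_n G n) by apply: bigcupT_measurable => n; exact: mgrid.
have PG : (P (\bigcup_n G n) <= (alpha^-1 * Linf s)%:E)%E.
  have PG : P \o G @ \oo --> P (\bigcup_n G n).
    apply: nondecreasing_cvg_mu => //; first by move=> n; exact: mgrid.
    by move=> n m nm; apply/subsetPset; exact: grid_event_nondecreasing.
  rewrite -(cvg_lim _ PG) //; apply: lime_le; first by apply/cvg_ex; eexists; exact: PG.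
  apply: nearW => n /=.
  rewrite -[leLHS]fineK; last by apply: fin_num_measure; exact: mgrid.
  rewrite lee_fin.
  by rewrite ler_pdivlMl // -LE //; exact: le_disc_limit.
rewrite -ler_pdivlMl // -lee_fin fineK ?fin_num_measure //; last exact: mMV.
apply: le_trans PG; rewrite -(measureU0 mG mN PN).
apply: le_measure; rewrite ?inE; [exact: mMV|exact: measurableU|].
move=> w wt.
have lscX := lsc_ge0_path (X0 w) _ _ (Zc w) Lr_homo Lr_usc.
have [s1 [/andP[s10 s1t] taus1 hit]] := hit_time_attained _ _ lscX t0 wt.
have [inf0|] := pselect (inf [set Z (s1 + r) w - Z s1 w
                          | r in `[0, (s - t) / 2]%classic] = 0).
  by right; apply: subN => /=; rewrite /tau taus1 /= ltry.
move=> inf_neq0; left.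
(* Without a dip, 0 would be a lower bound attained at [r = 0], so the infimum would be 0. *)
have [u [/andP[u0 uh] dip]] :
    exists u, 0 <= u <= (s - t) / 2 /\ Z (s1 + u) w < Z s1 w.
  apply: contrapT => nodip; apply: inf_neq0.
  have lb0 : lbound [set Z (s1 + r) w - Z s1 w | r in `[0, (s - t) / 2]%classic] 0.
    move=> v [r /=]; rewrite in_itv /= => rh <-.
    by rewrite leNgt; apply/negP => dip; apply: nodip; exists r; rewrite -subr_lt0.
  have in0 : [set Z (s1 + r) w - Z s1 w | r in `[0, (s - t) / 2]%classic] 0.
    by exists 0; rewrite ?addr0 ?subrr //= in_itv /= lexx ltW.
  apply/eqP; rewrite eq_le ge_inf //=; last by exists 0.
  by apply: lb_le_inf => //; exists 0.
have [n Gn] := dip_grid_event w s1 u s s10 u0 ltac:(lra) hit dip.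
by exists n.
Qed.

Lemma MV_solution_limit : MV_solution P alpha X0 Z Lr.
Proof.
move=> t t0; split; first exact: mMV.
apply/eqP; rewrite eq_le limit_le_hitting //=.
by apply: le_right_lim => s ts; exact: hitting_le_disc_limit.
Qed.

End limit_of_discretizations.

(** * Comparison with the minimal solution and convergence at continuity points *)

Theorem theorem2p9 (d : measure_display) (T : measurableType d) (R : realType)
  (P : probability T R) (alpha : R) (X0 : T -> R) (Z : R -> T -> R)
  (Lmin : R -> R) (Ldisc : nat -> R -> R) (Delta : nat -> R) :
  0 < alpha ->
  measurable_fun setT X0 ->
  (forall t, 0 <= t -> measurable_fun setT (Z t)) ->
  (forall w, {within `[0, +oo[, continuous (fun t => Z t w)}) ->
  (forall w, Z 0 w = 0) ->
  indep_X0_Z P X0 Z ->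
  crossing_property P X0 Z ->
  ((forall x : R, P (X0 @^-1` [set x]) = 0%E) \/
   (forall t, 0 < t -> forall x : R, P (Z t @^-1` [set x]) = 0%E)) ->
  (forall n, 0 < Delta n) ->
  (forall (n k : nat), exists m : nat, k%:R * Delta n = m%:R * Delta n.+1) ->
  Delta @ \oo --> 0 ->
  MV_minimal_solution P alpha X0 Z Lmin ->
  (forall n, disc_MV_minimal_solution P alpha X0 Z (Delta n) (Ldisc n)) ->
  forall t, 0 <= t -> {for t, continuous (M_elt alpha Lmin)} ->
    (fun n => alpha^-1 * Ldisc n t) @ \oo --> alpha^-1 * Lmin t.
Proof.
move=> alpha0 mX0 mZ Zc _ _ cross _ Delta0 nested Delta_cvg0 [Lsol Lmin_le] Ldisc_min.
move=> t t0 Lcont.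
have LE n s : 0 <= s ->
    Ldisc n s = alpha * fine (P (grid_event X0 Z (Delta n) (Ldisc n) s)).
  by move=> s0; apply: disc_MV_solutionE => //; exact: (Ldisc_min n).1.
have mgrid D L s : 0 < D -> measurable (grid_event X0 Z D L s).
  by move=> D0; exact: measurable_grid_event.
(* A finer-grid solution is a super-solution on the coarser grid, because fewer grid points leave
   fewer chances to hit. *)
have L_leS n s : 0 <= s -> Ldisc n s <= Ldisc n.+1 s.
  apply: (disc_MV_minimal_le _ _ _ mX0 mZ _ _ _ _ alpha0 (Delta0 n) (Ldisc_min n)).
  move=> {}s s0; rewrite [leRHS]LE // ler_pM2l //.
  apply: fine_probability_le; [exact: mgrid|exact: mgrid|].
  move=> w [j /= js wj]; have [j' jj'] := nested n j.
  by exists j'; rewrite /= -jj'.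
(* [Lmin] is a super-solution on every grid: a hit at a grid point is a hit in continuous time. *)
have L_leLmin n s : 0 <= s -> Ldisc n s <= Lmin s.
  apply: (disc_MV_minimal_le _ _ _ mX0 mZ _ _ _ _ alpha0 (Delta0 n) (Ldisc_min n)).
  move=> {}s s0; have [mMV ->] := Lsol s s0; rewrite ler_pM2l //.
  apply: fine_probability_le => //; first exact: mgrid.
  move=> w [j /= js wj].
  apply: (@le_trans _ _ (j%:R * Delta n)%:E); last by rewrite lee_fin.
  apply: hit_time_le; last by rewrite subr_le0.
  by rewrite mulr_ge0 ?ler0n // ltW.
have Lr_sol := MV_solution_limit P X0 Z alpha Delta Ldisc alpha0 mX0 mZ Zc cross
  Delta0 nested Delta_cvg0 LE L_leS.
pose Linf s := sup (range (Ldisc ^~ s)).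
have Linf_ge0 s : 0 <= s -> 0 <= Linf s.
  exact: (disc_limit_ge0 P X0 Z alpha Delta Ldisc alpha0 mX0 mZ Delta0 LE).
(* Negative [s] are included so that [t = 0] is covered: there, continuity of [M_elt] compares
   [Lmin 0] with the value 0 before time 0. *)
have Lmin_leLinf s : s < t -> M_elt alpha Lmin s <= alpha^-1 * Linf t.
  move=> st; rewrite /M_elt; case: ltP => s0.
    by rewrite mulr_ge0 ?Linf_ge0 // invr_ge0 ltW.
  rewrite ler_pM2l ?invr_gt0 //; apply: le_trans (Lmin_le _ Lr_sol _ s0) _.
  exact: (right_lim_le _ Linf_ge0).
have LinfE : Linf t = Lmin t.
  apply/eqP; rewrite eq_le; apply/andP; split.
    apply: ge_sup; first by exists (Ldisc 0%N t), 0%N.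
    by move=> _ [n _ <-]; exact: L_leLmin.
  rewrite -(ler_pM2l (_ : 0 < alpha^-1)) ?invr_gt0 //.
  have -> : alpha^-1 * Lmin t = M_elt alpha Lmin t by rewrite /M_elt ltNge t0.
  apply/ler_addgt0Pr => e e0.
  have /cvgrPdist_lt /(_ _ e0) /nbhs_ballP[b /= b0 bL] := Lcont.
  (* Only continuity from the left enters: the point [t - b / 2] lies in the ball and strictly
     before [t]. *)
  have := bL (t - b / 2); rewrite /ball /= opprB addrC subrK gtr0_norm; last lra.
  move=> /(_ ltac:(lra)); rewrite ltr_norml => /andP[_].
  have := Lmin_leLinf (t - b / 2) ltac:(lra); lra.
rewrite -LinfE; apply: cvgM; first exact: cvg_cst.
apply: nondecreasing_cvgn.
  move=> n m nm.
  exact: (disc_solution_nondecreasing Ldisc L_leS).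
by exists (Lmin t) => _ [n _ <-]; exact: L_leLmin.
Qed.
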